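(* Let $X$ be a compact metric $Z_2$-space with $\operatorname{ind}X=n$, covered by closed sets $U_1,\dots,U_N$ none of which contains a pair of antipodal points. Then there exists $x\in X$ such that at least $n+2$ of the sets $U_i$ contain $x$ or $\sigma(x)$.
   Context: $Z_2=\{1,\sigma\}$ acts continuously on $X$; points $x,\sigma(x)$ are called antipodal. $\operatorname{ind}X$ is the largest $n$ such that $w^n\neq0$ in $H^*_{Z_2}(X;Z_2)=H^*(X\times_{Z_2}EZ_2;Z_2)$ (Čech cohomology), where $w\in H^1$ is the pullback of the generator of $H^*(\mathbb RP^\infty;Z_2)=Z_2[w]$ ($\infty$ if there is no largest such $n$). *)

(* Defs.v *)
From HB Require Import structures.
From mathcomp Require Import all_boot all_order all_algebra generic_quotient.
From mathcomp Require Import all_classical all_reals all_analysis.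
Set Implicit Arguments.
Unset Strict Implicit.
Unset Printing Implicit Defensive.
Import Order.TTheory GRing.Theory Num.Theory.
Import numFieldNormedType.Exports.
Local Open Scope classical_set_scope.
Local Open Scope ring_scope.
Local Open Scope quotient_scope.

Record cech_cover (T : topologicalType) := CechCover {
  cover_index : Type;
  cover_set :> cover_index -> set T;
  cover_open : forall i, open (cover_set i);
  cover_full : \bigcup_i cover_set i = setT }.

(** A [p]-cochain of the nerve is a function of [p.+1] vertices.  It is given
    as a total function of all [p.+1]-tuples of indices; only its values on the
    tuples in [nerve] are meaningful, and every (in)equality of cochains below
    is tested on [nerve] only. *)
Definition cochain (A I : Type) (p : nat) := ('I_p.+1 -> I) -> A.

Section Cech.
Variables (A : comPzRingType) (T : topologicalType).

Definition nerve (U : cech_cover T) p (s : 'I_p.+1 -> cover_index U) :=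
  \bigcap_k U (s k) !=set0.

Definition coboundary (I : Type) p (c : cochain A I p) : cochain A I p.+1 :=
  fun s => \sum_(j < p.+2) (-1) ^+ j * c (fun k : 'I_p.+1 => s (lift j k)).

Definition cocycle (U : cech_cover T) p (c : cochain A (cover_index U) p) :=
  forall s : 'I_p.+2 -> cover_index U, nerve s -> coboundary c s = 0.

Definition exact_cochain (U : cech_cover T) p :
    cochain A (cover_index U) p -> Prop :=
  match p with
  | 0%N => fun c => forall s : 'I_1 -> cover_index U, nerve s -> c s = 0
  | q.+1 => fun c => exists b : cochain A (cover_index U) q,
      forall s : 'I_q.+2 -> cover_index U, nerve s -> c s = coboundary b s
  end.

Definition pull_cochain (I J : Type) (r : J -> I) p (c : cochain A I p) :
  cochain A J p := fun s => c (r \o s).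

(** The class of the cocycle [c] of [U] is zero in the direct limit, over the
    open covers of [T] ordered by refinement, of the cohomology groups of the
    nerves. *)
Definition cech_zero (U : cech_cover T) p (c : cochain A (cover_index U) p) :=
  exists (V : cech_cover T) (r : cover_index V -> cover_index U),
    (forall j, V j `<=` U (r j)) /\ @exact_cochain V p (pull_cochain r c).

Definition cochain_one (I : Type) : cochain A I 0 := fun=> 1.

(** The cup product with a 1-cochain on the left:
    [(a \cup b)(i_0, ..., i_(p+1)) = a(i_0, i_1) b(i_1, ..., i_(p+1))]. *)
Definition cup1 (I : Type) p (a : cochain A I 1) (b : cochain A I p) :
    cochain A I p.+1 :=
  fun s => a (fun k : 'I_2 => s (inord k)) *
           b (fun k : 'I_p.+1 => s (lift ord0 k)).

Fixpoint cup_exp (I : Type) (a : cochain A I 1) (n : nat) : cochain A I n :=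
  if n is m.+1 then cup1 a (@cup_exp I a m) else @cochain_one I.

End Cech.

Arguments nerve {T} U {p} s.
Arguments cocycle {A T} U {p} c.
Arguments exact_cochain {A T} U {p} c.
Arguments cech_zero {A T} U {p} c.
Arguments cup_exp {A I} a n.

Section PreimCover.
Variables (S T : topologicalType) (f : S -> T) (fc : continuous f).

Lemma preim_cover_open (U : cech_cover T) i : open (f @^-1` U i).
Proof. by move/continuousP: fc; apply; apply: cover_open. Qed.

Lemma preim_cover_full (U : cech_cover T) : \bigcup_i (f @^-1` U i) = setT.
Proof. by rewrite -preimage_bigcup cover_full preimage_setT. Qed.

(** Since [f @^-1` U] has the same index type as [U], a cochain [c] of [U] is
    also a cochain of [preim_cover U], and as such it represents the pullback
    under [f] of the class of [c]. *)
Definition preim_cover (U : cech_cover T) : cech_cover S :=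
  CechCover (@preim_cover_open U) (preim_cover_full U).

End PreimCover.

Record z2_action (T : topologicalType) := Z2Action {
  z2_act :> T -> T;
  z2_actK : involutive z2_act;
  z2_act_continuous : continuous z2_act }.

Section OrbitSpace.
Variables (T : topologicalType) (s : z2_action T).

Definition orbit_rel : rel T := fun x y => (x == y) || (x == s y).

Lemma orbit_rel_refl : reflexive orbit_rel.
Proof. by move=> x; rewrite /orbit_rel eqxx. Qed.

Lemma orbit_rel_sym : symmetric orbit_rel.
Proof.
move=> x y; rewrite /orbit_rel eq_sym; congr (_ || _).
by apply/eqP/eqP => ->; rewrite z2_actK.
Qed.

Lemma orbit_rel_trans : transitive orbit_rel.
Proof.
move=> y x z; rewrite /orbit_rel => /orP[/eqP->//|/eqP->].
by case/orP => /eqP->; rewrite ?z2_actK eqxx ?orbT.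
Qed.

Definition orbit_equiv :=
  EquivRel orbit_rel orbit_rel_refl orbit_rel_sym orbit_rel_trans.

Definition orbit_space : topologicalType :=
  quotient_topology {eq_quot orbit_equiv}.

Definition orbit_proj (x : T) : orbit_space := \pi_({eq_quot orbit_equiv}) x.

Definition orbit_repr (q : orbit_space) : T := repr (q : {eq_quot orbit_equiv}).

End OrbitSpace.

Section OrbitMap.
Variables (S T : topologicalType) (a : z2_action S) (b : z2_action T).
Variable f : S -> T.

Definition orbit_map (q : orbit_space a) : orbit_space b :=
  orbit_proj b (f (orbit_repr q)).

Hypotheses (fc : continuous f) (fe : forall x, f (a x) = b (f x)).

Lemma orbit_map_continuous : continuous orbit_map.
Proof.
apply: (@repr_comp_continuous S {eq_quot orbit_equiv a} _
  (fun x => orbit_proj b (f x))).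
- move=> x; apply: (@continuous_comp _ _ _ f (@orbit_proj T b) x).
    exact: fc.
  exact: (@pi_continuous T {eq_quot orbit_equiv b}).
- move=> x y /eqP/eqmodP/orP[/eqP->//|/eqP->]; rewrite fe.
  by apply/eqP/eqmodP; rewrite /= /orbit_rel eqxx orbT.
Qed.

End OrbitMap.

Section DiagonalAction.
Variables (S T : topologicalType) (a : z2_action S) (b : z2_action T).

Definition diag_fun (u : S * T) : S * T := (a u.1, b u.2).

Lemma diag_funK : involutive diag_fun.
Proof. by case=> x y; rewrite /diag_fun /= !z2_actK. Qed.

Lemma diag_fun_continuous : continuous diag_fun.
Proof.
move=> u; apply: cvg_pair.
- apply: (@continuous_comp _ _ _ fst a u); first exact: cvg_fst.
  exact: z2_act_continuous.
- apply: (@continuous_comp _ _ _ snd b u); first exact: cvg_snd.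
  exact: z2_act_continuous.
Qed.

Definition diag_action : z2_action (S * T)%type :=
  Z2Action diag_funK diag_fun_continuous.

End DiagonalAction.

(** EZ_2 is taken to be S^oo with the antipodal action.  Its points are the
    finitely supported unit sequences, that is, the points of the union of the
    spheres S^0, S^1, S^2, ...; the topology is the CW
    topology, for which a set is open iff its trace on each of these spheres is
    open in the euclidean topology. *)

Section InfSphere.
Variable R : realType.

Definition unit_finsupp (x : nat -> R) : bool :=
  `[< exists n, (forall i, (n <= i)%N -> x i = 0) /\
                \sum_(i < n) x i ^+ 2 = 1 >].

Record inf_sphere := InfSphere {
  sphere_coord :> nat -> R;
  sphere_coordP : unit_finsupp sphere_coord }.

HB.instance Definition _ := [isSub for sphere_coord].
HB.instance Definition _ := [Choice of inf_sphere by <:].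

Definition sphere_open (U : set inf_sphere) :=
  forall n, exists2 O : set 'rV[R]_n, open O &
    forall x : inf_sphere, (forall i, (n <= i)%N -> x i = 0) ->
      (U x <-> O (\row_i x i)).

Lemma sphere_openT : sphere_open setT.
Proof. by move=> n; exists setT; [exact: openT|]. Qed.

Lemma sphere_openI : setI_closed sphere_open.
Proof.
move=> U V oU oV n; have [G oG UG] := oU n; have [Q oQ VQ] := oV n.
exists (G `&` Q); first exact: openI.
by move=> x xn; rewrite /setI /= (UG x xn) (VQ x xn).
Qed.

Lemma sphere_open_bigU (I : Type) (f : I -> set inf_sphere) :
  (forall i, sphere_open (f i)) -> sphere_open (\bigcup_i f i).
Proof.
move=> fo n; pose O i := s2val (cid2 (fo i n)).
exists (\bigcup_i O i).
  by apply: bigcup_open => i _; rewrite /O; case: cid2.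
move=> x xn; split=> -[i _ xi]; exists i => //.
- by move: xi; rewrite /O; case: cid2 => /= P _ Px; case: (Px x xn).
- by move: xi; rewrite /O; case: cid2 => /= P _ Px; case: (Px x xn).
Qed.

HB.instance Definition _ := isOpenTopological.Build inf_sphere
  sphere_openT sphere_openI sphere_open_bigU.

Lemma sphere_openE : (open : set_system inf_sphere) = sphere_open.
Proof. by []. Qed.

Lemma unit_finsuppN (x : inf_sphere) : unit_finsupp (fun i => - x i).
Proof.
case: x => x /= /asboolP[n [x0 x1]]; apply/asboolP; exists n; split.
  by move=> i /x0 ->; rewrite oppr0.
by rewrite -x1; apply: eq_bigr => i _; rewrite sqrrN.
Qed.

Definition sphere_opp (x : inf_sphere) : inf_sphere :=
  InfSphere (unit_finsuppN x).

Lemma sphere_oppK : involutive sphere_opp.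
Proof. by move=> x; apply: val_inj; apply/funext => i /=; rewrite opprK. Qed.

Lemma sphere_opp_continuous : continuous sphere_opp.
Proof.
apply/continuousP => U; rewrite sphere_openE => oU n; have [G oG UG] := oU n.
exists (-%R @^-1` G).
  by apply: open_comp => // x _; exact: opp_continuous.
move=> x xn; rewrite /preimage /=.
have -> : - (\row_i x i) = \row_i sphere_opp x i :> 'rV[R]_n.
  by apply/rowP => i; rewrite !mxE.
by apply: UG => i ni /=; rewrite xn // oppr0.
Qed.

Definition antipodal : z2_action inf_sphere :=
  Z2Action sphere_oppK sphere_opp_continuous.

Definition inf_projective : topologicalType := orbit_space antipodal.

Section Index.
Variables (X : topologicalType) (sigma : z2_action X).

Definition borel_space : topologicalType :=
  orbit_space (diag_action sigma antipodal).

Definition borel_proj : borel_space -> inf_projective :=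
  @orbit_map _ _ (diag_action sigma antipodal) antipodal snd.

Lemma borel_proj_continuous : continuous borel_proj.
Proof. by apply: orbit_map_continuous => // x; exact: cvg_snd. Qed.

(** [H^1(RP^oo; Z_2)] is [Z_2], so the generator [w] of [H^*(RP^oo; Z_2)] is
    the class of any 1-cocycle whose class is not zero. *)
Definition generator (U : cech_cover inf_projective)
    (w : cochain 'F_2 (cover_index U) 1) :=
  cocycle U w /\ ~ cech_zero U w.

(** The [n]-th power of the pullback of the class of [w] is zero in
    [H^n(X x_(Z_2) EZ_2; Z_2)]. *)
Definition power_zero (U : cech_cover inf_projective)
    (w : cochain 'F_2 (cover_index U) 1) (n : nat) :=
  cech_zero (preim_cover borel_proj_continuous U) (cup_exp w n).

(** [ind X = n].  All the representatives [w] of the generator have the same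
    class, so the quantifier over [w] only says that the choice of a
    representative does not matter. *)
Definition ind_eq (n : nat) :=
  forall (U : cech_cover inf_projective)
         (w : cochain 'F_2 (cover_index U) 1),
    generator w ->
    ~ power_zero w n /\ forall m, ~ power_zero w m -> (m <= n)%N.

End Index.
End InfSphere.

(* Main.v *)
(** Suppose that every [x] lies in at most [n.+1] of the sets [U i `|` sigma (U i)].
It lies in at least two of them, since [x] and [sigma x] are in different [U i].
Cutting off differences of distance functions gives odd continuous functions
[psi i] of which, at each point, between [2] and [n.+1] are nonzero.  Summing
over the sets [S] of [k.+2] indices an odd expression in the [psi i], [i \in S],
that vanishes unless all of them are nonzero yields odd functions [phi k], [k < n],
without common zero.  So the orbit space is covered by the [n] open sets
[phi k != 0], over each of which the double cover, hence [w], is trivial, and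
[w ^ n = 0] as in the Lusternik-Schnirelmann bound by the cup length.

The class [w] itself is represented on the cover of [RP^oo] by the caps
[3 / 4 < `|dot p x|] by the cocycle recording the sign of [dot p q]; it is not a
coboundary because [S^oo] is connected. *)
Require Import Defs.
From mathcomp Require Import all_boot all_order all_algebra generic_quotient.
From mathcomp Require Import all_classical all_reals all_analysis.
From mathcomp Require Import ring lra zify.
Set Implicit Arguments.
Unset Strict Implicit.
Unset Printing Implicit Defensive.
Import Order.TTheory GRing.Theory Num.Theory.
Import numFieldNormedType.Exports.
Local Open Scope classical_set_scope.
Local Open Scope ring_scope.
Local Open Scope quotient_scope.

(** * Distance functions and continuity of real functions *)

Lemma closed_zero_set (R : realType) (X : metricType R) (A : set X) :
  closed A -> exists f : X -> R,
    [/\ continuous f, forall x, 0 <= f x & forall x, f x = 0 <-> A x].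
Proof.
move=> cA; have [A0|/set0P[a0 Aa0]] := eqVneq A set0.
  (* The infimum of the empty set is 0 by default, so an empty [A] needs its own function. *)
  exists (fun=> 1); split=> // [x|x]; first exact: cvg_cst.
  by rewrite A0; split=> // /eqP; rewrite oner_eq0.
pose D x := [set mdist x a | a in A].
have D0 x : D x !=set0 by exists (mdist x a0), a0.
have lbD x : lbound (D x) 0 by move=> _ [a _ <-]; exact: mdist_ge0.
have hlb x : has_lbound (D x) by exists 0.
pose f x := inf (D x).
have f_ge0 x : 0 <= f x by exact: lb_le_inf.
have f_le x a : A a -> f x <= mdist x a by move=> Aa; apply: ge_inf => //; exists a.
have fD x y : f x <= mdist x y + f y.
  rewrite -lerBlDl; apply: lb_le_inf => // _ [a Aa <-].
  by rewrite lerBlDl (le_trans (f_le x a Aa))// metric_triangle.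
exists f; split=> // [x|x].
  apply/cvgrPdist_lt => e e0; near=> y.
  have xy : mdist x y < e.
    near: y; have := nbhsx_ballx x e e0; rewrite ballEmdist; exact.
  rewrite ltr_distlC; have := fD x y; have := fD y x.
  rewrite [mdist y x]metric_sym; lra.
split=> [fx|Ax]; last first.
  by apply/eqP; rewrite eq_le f_ge0 -(mdistxx x) f_le.
apply: cA => V /nbhs_ballP[e /= e0 eV].
have [_ [a Aa <-] ae] : exists2 y, D x y & y < e.
  by apply: inf_lt => //; rewrite -/(f x) fx.
by exists a; split=> //; apply: eV; rewrite ballEmdist.
Unshelve. all: by end_near. Qed.

(** An arbitrary [op] lets one induction serve sums, products, minima and maxima. *)
Lemma continuous_big (R : realType) (X : topologicalType) (op : R -> R -> R)
    (idx : R) (I : Type) (r : seq I) (P : pred I) (F : I -> X -> R) :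
  (forall f g : X -> R, continuous f -> continuous g ->
     continuous (fun x => op (f x) (g x))) ->
  (forall i, P i -> continuous (F i)) ->
  continuous (fun x => \big[op/idx]_(i <- r | P i) F i x).
Proof.
move=> opc Fc.
pose G r x := \big[op/idx]_(i <- r | P i) F i x.
rewrite -/(G r); elim: r => [|i r IH].
  have -> : G [::] = fun=> idx by apply/funext => x; rewrite /G big_nil.
  by move=> x; exact: cvg_cst.
have -> : G (i :: r) = fun x => if P i then op (F i x) (G r x) else G r x.
  by apply/funext => x; rewrite /G big_cons.
by case Pi: (P i) => //; apply: opc => //; exact: Fc.
Qed.

Section ContinuousOps.
Variables (R : realType) (X : topologicalType).
Implicit Types f g : X -> R.

Lemma continuous_add_fun f g : continuous f -> continuous g ->
  continuous (fun x => f x + g x).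
Proof. by move=> fc gc x; apply: cvgD; [exact: fc|exact: gc]. Qed.

Lemma continuous_mul_fun f g : continuous f -> continuous g ->
  continuous (fun x => f x * g x).
Proof. by move=> fc gc x; apply: cvgM; [exact: fc|exact: gc]. Qed.

Lemma continuous_opp_fun f : continuous f -> continuous (fun x => - f x).
Proof. by move=> fc x; apply: cvgN; exact: fc. Qed.

Lemma continuous_min_fun f g : continuous f -> continuous g ->
  continuous (fun x => Num.min (f x) (g x)).
Proof. by move=> fc gc x; apply: continuous_min; [exact: fc|exact: gc]. Qed.

Lemma continuous_max_fun f g : continuous f -> continuous g ->
  continuous (fun x => Num.max (f x) (g x)).
Proof. by move=> fc gc x; apply: continuous_max; [exact: fc|exact: gc]. Qed.

Lemma continuous_norm_fun f : continuous f -> continuous (fun x => `|f x|).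
Proof. by move=> fc x; apply: cvg_norm; exact: fc. Qed.

End ContinuousOps.

(** * Odd functions from the closed cover *)

Lemma odd_family_of_cover (R : realType) (X : metricType R)
    (sigma : z2_action X) (n N : nat) (U : 'I_N -> set X) :
  (forall i, closed (U i)) -> \bigcup_i U i = [set: X] ->
  (forall i, ~ exists x, U i x /\ U i (sigma x)) ->
  (forall x, (#|[set i : 'I_N | `[< U i x \/ U i (sigma x) >]]%SET| <= n.+1)%N) ->
  exists psi : 'I_N -> X -> R,
    [/\ forall i, continuous (psi i),
        forall i x, psi i (sigma x) = - psi i x &
        forall x, (1 < #|[set i | psi i x != 0%R]%SET| <= n.+1)%N].
Proof.
move=> Ucl Ucov Uanti Ucard.
have sc : continuous sigma by exact: z2_act_continuous.
have sK : involutive sigma by exact: z2_actK.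
have /choice[d dP] i := closed_zero_set (Ucl i).
have dc i : continuous (d i) by case: (dP i).
have d_ge0 i x : 0 <= d i x by case: (dP i).
have d0 i x : d i x = 0 <-> U i x by case: (dP i).
have dsc i : continuous (fun x => d i (sigma x)).
  by move=> x; apply: continuous_comp; [exact: sc|exact: dc].
pose m i x := d i x * d i (sigma x).
have mc i : continuous (m i) by exact: continuous_mul_fun.
have ms i x : m i (sigma x) = m i x by rewrite /m sK mulrC.
have m_ge0 i x : 0 <= m i x by exact: mulr_ge0.
have m0 i x : m i x = 0 <-> U i x \/ U i (sigma x).
  rewrite -!d0 /m; split=> [/eqP|[]->]; rewrite ?mulr0 ?mul0r//.
  by rewrite mulf_eq0 => /orP[]/eqP; [left|right].
(* [delta x] is the minimum of [1] and the [n.+2]-nd smallest number [m i x]. *)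
pose delta x := \big[Num.min/1]_(S : {set 'I_N} | #|S| == n.+2)
  \big[Num.max/0]_(i in S) m i x.
have deltac : continuous delta.
  apply: continuous_big => [f g|S _]; first exact: continuous_min_fun.
  by apply: continuous_big => // f g; exact: continuous_max_fun.
have deltas x : delta (sigma x) = delta x.
  by apply: eq_bigr => S _; apply: eq_bigr => i _; rewrite ms.
(* By [Ucard], any [n.+2] indices include one with [m i x != 0]; without sets of that size the
   default 1 remains. *)
have delta_gt0 x : 0 < delta x.
  rewrite /delta; elim/big_ind: _ => // [a b a0 b0|S /eqP Scard].
    by rewrite lt_min a0.
  have [i iS mi] : exists2 i, i \in S & m i x != 0.
    apply/exists_inP; apply: contraT => /exists_inPn /= mS.
    have := leq_trans (subset_leq_card _) (Ucard x).
    move=> /(_ (mem S)); rewrite Scard ltnn => -> //.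
    apply/fintype.subsetP => i /mS /negPn/eqP/m0 Ui.
    by rewrite inE; apply/asboolP.
  by apply: lt_le_trans (le_bigmax_cond _ _ iS); rewrite lt_neqAle eq_sym mi /=.
have delta_card x : (#|[set i | (m i x < delta x)%R]%SET| <= n.+1)%N.
  rewrite leqNgt; apply/negP => /card_geqP[s [us ss sS]].
  have Scard : #|[set i in s]%SET| == n.+2.
    by rewrite cardsE (card_uniqP us) ss.
  have := @bigmin_le_cond _ R _ 1 _ (fun S : {set 'I_N} => #|S| == n.+2)
    (fun S : {set 'I_N} => \big[Num.max/0]_(i in S) m i x) Scard.
  rewrite -/(delta x) leNgt => /negP; apply.
  apply/bigmax_ltP; split=> // i; rewrite inE => /sS.
  by rewrite inE.
(* The first factor is odd and nonzero where [m i x = 0]; the second is an invariant cut-off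
   vanishing unless [m i x < delta x]. *)
pose psi i x := (d i (sigma x) - d i x) * Num.max 0 (delta x - m i x).
have psiU i x : U i x -> psi i x != 0.
  move=> Ux; have mx : m i x = 0 by apply/m0; left.
  rewrite /psi mx subr0 (proj2 (d0 i x) Ux) subr0 max_r ?(ltW (delta_gt0 _))//.
  rewrite mulf_neq0 ?(gt_eqF (delta_gt0 _))//.
  by apply/eqP => /d0 Usx; apply: (Uanti i); exists x.
have psiN i x : psi i (sigma x) = - psi i x.
  by rewrite /psi sK deltas ms -[RHS]mulNr opprB.
exists psi; split=> // [i|x].
  apply: continuous_mul_fun.
    by apply: continuous_add_fun => //; exact: continuous_opp_fun.
  apply: continuous_max_fun; first by move=> x; exact: cvg_cst.
  by apply: continuous_add_fun => //; exact: continuous_opp_fun.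
apply/andP; split; last first.
  apply: leq_trans (delta_card x); apply/subset_leq_card/fintype.subsetP => i.
  rewrite !inE; apply: contraR; rewrite -leNgt => dm.
  by rewrite /psi max_l ?mulr0// subr_le0.
have cov y : exists i, U i y.
  by have : [set: X] y by []; rewrite -Ucov => -[i _ ?]; exists i.
have [[i Ui] [j Uj]] := (cov x, cov (sigma x)).
apply/card_gt1P; exists i, j; rewrite !inE psiU//; split=> //.
  by rewrite -oppr_eq0 -psiN psiU.
by apply/eqP => ij; apply: (Uanti i); exists x; rewrite {2}ij.
Qed.

(* At a point where exactly [k.+2] of the functions [psi i] are nonzero, the only
   nonzero term of the [k]-th sum is the one of the set of these indices. *)
Lemma odd_family_nowhere_zero (R : realType) (X : topologicalType)
    (s : X -> X) (n : nat) (I : finType) (psi : I -> X -> R) :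
  (forall i, continuous (psi i)) ->
  (forall i x, psi i (s x) = - psi i x) ->
  (forall x, (1 < #|[set i | psi i x != 0%R]%SET| <= n.+1)%N) ->
  exists phi : 'I_n -> X -> R,
    [/\ forall k, continuous (phi k),
        forall k x, phi k (s x) = - phi k x &
        forall x, exists k, phi k x != 0].
Proof.
move=> psic psiN psicard.
(* The index picked from [S] does not depend on [x]. One signed factor times absolute values is odd
   whatever the parity of [#|S|]. *)
pose lead (S : {set I}) x := if [pick i in S] is Some i then psi i x else 0.
pose phi (k : 'I_n) x :=
  \sum_(S : {set I} | #|S| == k.+2) lead S x * \prod_(i in S) `|psi i x|.
exists phi; split=> [k|k x|x].
- apply: continuous_big => [f g|S _]; first exact: continuous_add_fun.
  apply: continuous_mul_fun; last first.
    apply: continuous_big => [f g|i _]; first exact: continuous_mul_fun.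
    exact: continuous_norm_fun.
  rewrite /lead; case: pickP => [i _|_]; first exact: psic.
  by move=> x; exact: cvg_cst.
- rewrite /phi -sumrN; apply: eq_bigr => S _; rewrite -mulNr; congr (_ * _).
    by rewrite /lead; case: pickP => [i _|_]; rewrite ?psiN ?oppr0.
  by apply: eq_bigr => i _; rewrite psiN normrN.
have /andP[] := psicard x; set S0 := [set i | _]%SET => S1 Sn.
have kn : (#|S0| - 2 < n)%N by lia.
exists (Ordinal kn); rewrite /phi (bigD1 S0) /=; last by apply/eqP; lia.
rewrite [X in _ + X]big1 ?addr0 => [|S /andP[/eqP Scard SS0]].
  rewrite mulf_neq0//; last first.
    by apply/prodf_neq0 => i; rewrite inE normr_eq0.
  rewrite /lead; case: pickP => [i|S00]; first by rewrite inE.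
  by move: S1; rewrite (eq_card0 S00).
(* Being distinct from [S0] and of the same size, [S] is not contained in it. *)
have [i iS pi0] : exists2 i, i \in S & psi i x == 0.
  apply/exists_inP; apply: contraNT SS0 => /exists_inPn /= SS.
  rewrite finset.eqEcard Scard; apply/andP; split; last by lia.
  by apply/fintype.subsetP => i iS; rewrite inE SS.
by rewrite (bigD1 i)//= (eqP pi0) normr0 mul0r mulr0.
Qed.

(** * Inner product and connectedness of the infinite sphere *)

Section Dot.
Variable R : realType.
Implicit Types p q x : inf_sphere R.

Definition sphere_dim x : nat :=
  projT1 (cid (asboolP _ (sphere_coordP x))).

Lemma sphere_dim0 x i : (sphere_dim x <= i)%N -> x i = 0.
Proof. by rewrite /sphere_dim; case: cid => n /= [x0 _]; exact: x0. Qed.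

Lemma sphere_dim1 x : \sum_(i < sphere_dim x) x i ^+ 2 = 1.
Proof. by rewrite /sphere_dim; case: cid => n /= []. Qed.

(** The range depends on [p] alone, so [dot p] is a fixed finite combination of coordinates, hence
    continuous. *)
Definition dot p x : R := \sum_(i < sphere_dim p) p i * x i.

Lemma sum_widen n m (F : nat -> R) : (n <= m)%N ->
  (forall i, (n <= i)%N -> F i = 0) -> \sum_(i < m) F i = \sum_(i < n) F i.
Proof.
move=> nm F0; rewrite (big_ord_widen m F nm) [RHS]big_mkcond /=.
by apply: eq_bigr => i _; case: ltnP => // /F0.
Qed.

Lemma dotE m p x : (sphere_dim p <= m)%N -> dot p x = \sum_(i < m) p i * x i.
Proof.
move=> pm; symmetry; apply: (sum_widen (F := fun i => p i * x i)) => // i pi.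
by rewrite sphere_dim0// mul0r.
Qed.

Lemma dot_norm m x : (sphere_dim x <= m)%N -> \sum_(i < m) x i ^+ 2 = 1.
Proof.
move=> xm; rewrite -(sphere_dim1 x).
apply: (sum_widen (F := fun i => x i ^+ 2)) => // i xi.
by rewrite sphere_dim0// expr0n.
Qed.

Lemma dotxx x : dot x x = 1.
Proof. by rewrite -(sphere_dim1 x); apply: eq_bigr => i _; rewrite expr2. Qed.

Lemma dotC p q : dot p q = dot q p.
Proof.
pose m := maxn (sphere_dim p) (sphere_dim q).
rewrite !(dotE (m := m)) ?leq_maxl ?leq_maxr//.
by apply: eq_bigr => i _; rewrite mulrC.
Qed.

Lemma dotNr p x : dot p (sphere_opp x) = - dot p x.
Proof. by rewrite -sumrN; apply: eq_bigr => i _; rewrite mulrN. Qed.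

Lemma dotNl p x : dot (sphere_opp p) x = - dot p x.
Proof. by rewrite dotC dotNr dotC. Qed.

(* This is [0 <= |p + q - 2x|^2]. *)
Lemma dot_triangle p q x : 2 * dot p x + 2 * dot q x <= dot p q + 3.
Proof.
pose m := maxn (maxn (sphere_dim p) (sphere_dim q)) (sphere_dim x).
have pm : (sphere_dim p <= m)%N by rewrite /m; lia.
have qm : (sphere_dim q <= m)%N by rewrite /m; lia.
have xm : (sphere_dim x <= m)%N by rewrite /m; lia.
have : 0 <= \sum_(i < m) (p i + q i - 2 * x i) ^+ 2.
  by apply: sumr_ge0 => i _; exact: sqr_ge0.
have -> : \sum_(i < m) (p i + q i - 2 * x i) ^+ 2 =
    \sum_(i < m) p i ^+ 2 + \sum_(i < m) q i ^+ 2 + 4 * \sum_(i < m) x i ^+ 2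
    + 2 * dot p q - 4 * dot p x - 4 * dot q x.
  rewrite !(dotE (m := m))// !mulr_sumr -!sumrN -!big_split/=.
  by apply: eq_bigr => i _; ring.
rewrite !dot_norm//; lra.
Qed.

(** If both products exceed 3/4, the left side of [dot_triangle] exceeds 3, so [dot p q] is
    positive. The other signs follow by passing to antipodes of [p] and [q]. *)
Lemma dot_sign p q x : 3 / 4 < `|dot p x| -> 3 / 4 < `|dot q x| ->
  (dot p q < 0) = (dot p x < 0) (+) (dot q x < 0).
Proof.
have := dot_triangle p q x; have := dot_triangle (sphere_opp p) q x.
have := dot_triangle p (sphere_opp q) x.
have := dot_triangle (sphere_opp p) (sphere_opp q) x.
rewrite !(dotNl, dotNr).
case: (ltP (dot p x) 0) => px; case: (ltP (dot q x) 0) => qx;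
  rewrite ?(ltr0_norm px) ?(ltr0_norm qx) ?(ger0_norm px) ?(ger0_norm qx) /=.
all: by move=> *; first [apply/negbTE; rewrite -leNgt; lra | apply/idP; lra].
Qed.

Lemma sphere_coord_continuous i : continuous (fun x : inf_sphere R => x i).
Proof.
apply/continuousP => O oO; rewrite sphere_openE => n.
have [ni|ni] := ltnP i n; last first.
  exists [set _ | O 0]; last by move=> x xn; rewrite /preimage /= xn.
  have [Oz|nOz] := pselect (O 0).
    have -> : [set _ : 'rV[R]_n | O 0] = setT by apply/seteqP; split.
    exact: openT.
  have -> : [set _ : 'rV[R]_n | O 0] = set0 by apply/seteqP; split.
  exact: open0.
exists ((fun v : 'rV[R]_n => v ord0 (Ordinal ni)) @^-1` O).
  by apply: open_comp => // v _; exact: coord_continuous.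
by move=> x xn; rewrite /preimage /= mxE.
Qed.

Lemma dot_continuous p : continuous (dot p).
Proof.
apply: continuous_big => [f g|i _]; first exact: continuous_add_fun.
apply: (@continuous_mul_fun _ _ (fun=> p i)); last exact: sphere_coord_continuous.
exact: cst_continuous.
Qed.

(** A great circle, used as a path from a point to its antipode. *)
Definition arc_coord (t : R) (i : nat) : R :=
  if i is j.+1 then if j is _.+1 then 0 else sin t else cos t.

Lemma arc_unit t : unit_finsupp (arc_coord t).
Proof.
apply/asboolP; exists 2%N; split; first by case=> [|[]].
by rewrite !big_ord_recl big_ord0 /= addr0 cos2Dsin2.
Qed.

Definition arc t : inf_sphere R := InfSphere (arc_unit t).

Lemma arc_pi : arc pi = sphere_opp (arc 0).
Proof.
apply/val_inj/funext => -[|[|i]] /=; rewrite ?cos0 ?cospi ?sin0 ?sinpi ?oppr0//.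
Qed.

Lemma arc_continuous : continuous arc.
Proof.
(* The arc stays in the circle of the first two coordinates, so the trace of [W] for [n = 2]
   decides. *)
apply/continuousP => W; rewrite sphere_openE => /(_ 2%N)[Q oQ WQ].
have -> : arc @^-1` W = (fun t => \row_(i < 2) arc t i) @^-1` Q.
  apply/seteqP; split=> t /=; have := WQ (arc t) _.
    by move=> /(_ _)[]// [|[]].
  by move=> /(_ _)[]// [|[]].
apply: open_comp => // t _ A [P Pn PA].
have arcc i : continuous (arc_coord ^~ i).
  case: i => [|[|i]] /=.
  - exact: continuous_cos.
  - exact: continuous_sin.
  - by move=> u; exact: cst_continuous.
have : \forall u \near nbhs t, forall i j, P i j ((\row_(k < 2) arc u k) i j).
  apply: filter_forall => i; apply: filter_forall => j.
  have arcP : \forall u \near t, P i j (arc_coord u j).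
    by have := Pn i j; rewrite mxE => /(arcc j t).
  by apply: filterS arcP => u; rewrite mxE.
by apply: filterS => u Pu; apply: PA.
Qed.

(** Along [arc] the function is locally constant on the connected line, yet it takes both values, at
    [0] and at [pi]. *)
Lemma no_odd_locally_constant (g : inf_sphere R -> bool) :
  (forall x, g (sphere_opp x) = ~~ g x) -> (forall b, open [set x | g x = b]) ->
  False.
Proof.
move=> gN go.
pose A := arc @^-1` [set x | g x = true].
have Ao b : open (arc @^-1` [set x | g x = b]).
  by apply: open_comp => // t _; exact: arc_continuous.
have /clopen_separatedP sepA : clopen A.
  split; first exact: Ao.
  rewrite -openC (_ : ~` A = arc @^-1` [set x | g x = false]); first exact: Ao.
  by apply/seteqP; split=> t; rewrite /A /=; case: (g (arc t)).
have /connectedP/(_ (fun b => if b then ~` A else A)) : connected [set: R].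
  by apply/connected_intervalP.
apply; split=> //; last by rewrite setUv.
have gpi : g (arc pi) = ~~ g (arc 0) by rewrite arc_pi gN.
move=> b; have [t gt] : exists t, g (arc t) = ~~ b.
  have [g0|g0] := eqVneq (g (arc 0)) (~~ b); first by exists 0.
  by exists pi; rewrite gpi; case: (g (arc 0)) b g0 => -[].
by exists t; case: b gt => /= gt; rewrite /A /= gt.
Qed.

End Dot.

(** * Cochains with coefficients mod 2 and powers of a 1-cocycle *)

Section CochainsF2.
Variable I : Type.
Implicit Types (p q : nat) (a : I -> 'F_2) (w : cochain 'F_2 I 1).

Lemma F2_addrr (x : 'F_2) : x + x = 0.
Proof. by rewrite addrr_pchar2 // pchar_Fp. Qed.

Lemma F2_oppr (x : 'F_2) : - x = x.
Proof. by rewrite oppr_pchar2 // pchar_Fp. Qed.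

Lemma F2_addb (b c : bool) : (b (+) c)%:R = b%:R + c%:R :> 'F_2.
Proof. by case: b; case: c; rewrite /= ?addr0 ?add0r ?F2_addrr. Qed.

Lemma coboundaryE p (c : cochain 'F_2 I p) (s : 'I_p.+2 -> I) :
  coboundary c s = \sum_(j < p.+2) c (fun k => s (lift j k)).
Proof.
by apply: eq_bigr => j _; rewrite -signr_odd F2_oppr expr1n mul1r.
Qed.

(** Extending the vertices to [nat] turns the three edges of a triangle into the maps [k.+1],
    [2 * k] and [k], free of [lift]. *)
Lemma coboundary1E w (s : 'I_3 -> I) (t : nat -> I) :
  (forall k, s k = t k) ->
  coboundary w s = w (fun k => t k.+1) + w (fun k => t (2 * k)%N) + w (fun k => t k).
Proof.
move=> st; rewrite coboundaryE !big_ord_recl big_ord0 addr0 addrA.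
congr (w _ + w _ + w _); apply/funext => -[[|[|//]] lk]; rewrite st //=.
Qed.

(** Leibniz rule for [w] closed on the front triangle: the faces omitting vertices 0 and 1 add up to
    the first term on the right, and the other faces match one by one. *)
Lemma coboundary_cup1 w q (b : cochain 'F_2 I q) (s : 'I_q.+3 -> I) :
  coboundary w (fun k : 'I_3 => s (inord k)) = 0 ->
  coboundary (cup1 w b) s = cup1 w (coboundary b) s.
Proof.
pose t i := s (inord i).
have st k : s k = t k by rewrite /t inord_val.
rewrite (@coboundary1E _ (fun k : 'I_3 => s (inord k)) t) // => w0.
rewrite coboundaryE /cup1 coboundaryE.
rewrite big_ord_recl big_ord_recl [in RHS]big_ord_recl mulrDr addrA.
have e2 (j : 'I_q.+3) (u : nat -> I) : (forall k : 'I_2, t (bump j k) = u k) ->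
    w (fun k : 'I_2 => s (lift j (inord k))) = w (fun k => u k).
  move=> tu; congr w; apply/funext => k; rewrite st /= -tu inordK//.
  by have := ltn_ord k; lia.
congr (_ + _).
  rewrite (e2 _ (fun k => t k.+1)) // (e2 _ (fun k => t (2 * k)%N)); last first.
    by case=> -[|[|//]].
  have -> : (fun k : 'I_q.+1 => s (lift (lift ord0 ord0) (lift ord0 k))) =
            (fun k : 'I_q.+1 => s (lift ord0 (lift ord0 k))).
    by apply/funext => k; rewrite !st.
  rewrite -mulrDl; congr (_ * _).
  have -> : (fun k : 'I_2 => s (inord k)) = (fun k => t k) by [].
  by move/eqP: w0; rewrite addr_eq0 F2_oppr => /eqP.
rewrite mulr_sumr; apply: eq_bigr => j _; congr (_ * _).
  rewrite (e2 _ t) //; case=> -[|[|//]] //= _; rewrite /bump /=.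
congr b; apply/funext => k; rewrite !st /=; congr t; rewrite /bump; lia.
Qed.

(** All faces but the one omitting vertex 0 carry the factor [a (s ord0)], and their [W]-values add
    up to that of the remaining face. *)
Lemma coboundary_scale a q (W : cochain 'F_2 I q) (s : 'I_q.+2 -> I) :
  coboundary W s = 0 ->
  coboundary (fun u : 'I_q.+1 -> I => a (u ord0) * W u) s =
  (a (s ord0) + a (s (lift ord0 ord0))) * W (fun k => s (lift ord0 k)).
Proof.
rewrite coboundaryE big_ord_recl => /eqP; rewrite addr_eq0 F2_oppr => /eqP W0.
rewrite coboundaryE big_ord_recl addrC mulrDl; congr (_ + _).
rewrite W0 mulr_sumr; apply: eq_bigr => j _; congr (a (s _) * _).
exact: val_inj.
Qed.

(** This is [w] plus the coboundary of the 0-cochain [a]. *)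
Definition twist w a : cochain 'F_2 I 1 := fun s => w s + a (s ord0) + a (s ord_max).

(** On the nerve, for a cocycle [w], every factor is cohomologous to [w], so this also represents
    the [m]-th power; [a] can be chosen to make it vanish. *)
Fixpoint twist_prod w (a : nat -> I -> 'F_2) l m : cochain 'F_2 I m :=
  if m is m'.+1 then cup1 (twist w (a l)) (@twist_prod w a l.+1 m')
  else @cochain_one 'F_2 I.

Arguments twist_prod : clear implicits.

Lemma coboundary_twist w a (s : 'I_3 -> I) :
  coboundary (twist w a) s = coboundary w s.
Proof.
pose t i := s (inord i).
have st k : s k = t k by rewrite /t inord_val.
rewrite !(coboundary1E _ st) /twist /= !muln1 !muln0.
set x := w _; set y := w _; set z := w _.
have -> : x + a (t 1%N) + a (t 2%N) + (y + a (t 0%N) + a (t 2%N)) +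
     (z + a (t 0%N) + a (t 1%N)) = x + y + z + ((a (t 0%N) + a (t 0%N)) +
     (a (t 1%N) + a (t 1%N)) + (a (t 2%N) + a (t 2%N))) by ring.
by rewrite !F2_addrr !addr0.
Qed.

Lemma cup1_twist w a q (W : cochain 'F_2 I q) (s : 'I_q.+2 -> I) :
  cup1 (twist w a) W s = cup1 w W s +
  (a (s ord0) + a (s (lift ord0 ord0))) * W (fun k => s (lift ord0 k)).
Proof.
rewrite /cup1 /twist -mulrDl; congr (_ * _); rewrite -addrA.
congr (_ + (a (s _) + a (s _))); apply: val_inj; rewrite /= inordK//.
Qed.

(** One vanishing factor suffices. Asking for all pairs of vertices of [s] avoids locating the edge
    on which that factor is evaluated. *)
Lemma twist_prod_eq0 w (a : nat -> I -> 'F_2) l m (s : 'I_m.+1 -> I)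
    (i : nat) :
  (i < m)%N ->
  (forall e : 'I_2 -> I, (forall k, exists x, e k = s x) ->
     twist w (a (l + i)%N) e = 0) ->
  twist_prod w a l m s = 0.
Proof.
elim: m l i s => // m IH l [|i] s im e0 /=; rewrite /cup1.
  by rewrite addn0 in e0; rewrite e0 ?mul0r// => k; exists (inord k).
rewrite [X in _ * X](IH l.+1 i) ?mulr0// => e es; rewrite addSnnS; apply: e0.
by move=> k; have [x ->] := es k; exists (lift ord0 x).
Qed.

End CochainsF2.

Arguments twist_prod {I} w a l m.

Section Nerve.
Variables (T : topologicalType) (V : cech_cover T).
Local Notation I := (cover_index V).
Variables (w : cochain 'F_2 I 1) (w_cocycle : cocycle V w).

Lemma nerve_comp p q (s : 'I_p.+1 -> I) (f : 'I_q.+1 -> 'I_p.+1) :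
  nerve V s -> nerve V (s \o f).
Proof. by case=> x sx; exists x => k _; exact: sx. Qed.

Lemma twist_prod_cocycle a l m : cocycle V (twist_prod w a l m).
Proof.
elim: m l => [|m IH] l s ns /=.
  by rewrite coboundaryE !big_ord_recl big_ord0 addr0 F2_addrr.
rewrite coboundary_cup1 ?coboundary_twist.
  by rewrite /cup1 IH ?mulr0//; exact: (nerve_comp (lift ord0)).
by apply: w_cocycle; apply: (nerve_comp (fun k : 'I_3 => inord k)).
Qed.

Lemma cup_exp_twist a l m : exists b : cochain 'F_2 I m, forall s, nerve V s ->
  twist_prod w a l m.+1 s = cup_exp w m.+1 s + coboundary b s.
Proof.
elim: m l => [|m IH] l.
  exists (fun u => a l (u ord0) * 1) => s ns.
  rewrite [LHS]cup1_twist (@coboundary_scale _ (a l) _ (@cochain_one 'F_2 I))//.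
  exact: (twist_prod_cocycle a l (m := 0)).
have [b bP] := IH l.+1.
(* If [P] is the product of the remaining factors and [P = w^(m+1) + db], then
   [(w + da)P = w^(m+2) + d(wb) + d(aP)], as [w] and [P] are cocycles. *)
exists (fun u => cup1 w b u + a l (u ord0) * twist_prod w a l.+1 m.+1 u) => s ns.
have nl : nerve V (fun k => s (lift ord0 k)) by exact: (nerve_comp (lift ord0)).
have -> : coboundary
    (fun u => cup1 w b u + a l (u ord0) * twist_prod w a l.+1 m.+1 u) s = coboundary (cup1 w b) s +
    coboundary (fun u => a l (u ord0) * twist_prod w a l.+1 m.+1 u) s.
  by rewrite !coboundaryE -big_split.
rewrite [LHS]cup1_twist coboundary_cup1; last first.
  by apply: w_cocycle; apply: (nerve_comp (fun k : 'I_3 => inord k)).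
rewrite coboundary_scale; last exact: twist_prod_cocycle.
rewrite [cup1 w (twist_prod _ _ _ _) s]/cup1 bP// addrA mulrDr; congr (_ + _).
by rewrite -(bP _ nl).
Qed.

Lemma cup_exp_exact (a : nat -> I -> 'F_2) m :
  (forall s, nerve V s -> twist_prod w a 0 m s = 0) -> exact_cochain V (cup_exp w m).
Proof.
(* For [m = 0] both cochains are the constant 1, and exactness means vanishing on the nerve. *)
case: m => [//|m] a0; have [b bP] := cup_exp_twist a 0 m.
exists b => s ns; have /eqP := bP s ns.
by rewrite a0// eq_sym addr_eq0 F2_oppr => /eqP.
Qed.

End Nerve.

(** * Orbit spaces and invariant open sets *)

Section Orbit.
Variables (T : topologicalType) (s : z2_action T).

Lemma orbit_reprK (q : orbit_space s) : orbit_proj s (orbit_repr q) = q.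
Proof. exact: reprK. Qed.

Lemma orbit_projE x y : orbit_proj s x = orbit_proj s y <-> x = y \/ x = s y.
Proof.
split=> [/eqmodP/orP[]/eqP|xy]; [by left|by right|].
by apply/eqmodP/orP; case: xy => ->; rewrite eqxx; [left|right].
Qed.

Lemma orbit_repr_proj x :
  orbit_repr (orbit_proj s x) = x \/ orbit_repr (orbit_proj s x) = s x.
Proof. by apply/orbit_projE; rewrite orbit_reprK. Qed.

Lemma orbit_proj_act x : orbit_proj s (s x) = orbit_proj s x.
Proof. by apply/orbit_projE; right. Qed.

Lemma orbit_proj_continuous : continuous (orbit_proj s).
Proof. exact: (@pi_continuous T {eq_quot orbit_equiv s}). Qed.

Section Invariant.
Variables (P : set T) (Ps : forall x, P x -> P (s x)).

Lemma invariant_repr x : P (orbit_repr (orbit_proj s x)) <-> P x.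
Proof.
have [->//|->] := orbit_repr_proj x; split=> [/Ps|/Ps//].
by rewrite z2_actK.
Qed.

(** Invariance makes the choice of representative harmless: the preimage under the projection is [P]
    itself. *)
Lemma open_invariant : open P -> open [set q : orbit_space s | P (orbit_repr q)].
Proof.
rewrite {2}/open /= /quotient_open => oP; rewrite (_ : _ @^-1` _ = P) //.
by apply/seteqP; split=> x /invariant_repr.
Qed.

End Invariant.
End Orbit.

(** * A representative of the generator *)

Section Generator.
Variable R : realType.

Definition cap (p : inf_sphere R) : set (inf_sphere R) :=
  [set x | 3 / 4 < `|dot p x|].

Lemma cap_open p : open (cap p).
Proof.
apply: (@open_comp _ _ (fun x => `|dot p x|) [set y | 3 / 4 < y]).
  by move=> x _; apply: continuous_norm_fun; exact: dot_continuous.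
exact: open_gt.
Qed.

Lemma cap_opp p x : cap p x -> cap p (antipodal R x).
Proof. by rewrite /cap /= dotNr normrN. Qed.

Lemma cap_full : \bigcup_p [set q : inf_projective R | cap p (orbit_repr q)] = setT.
Proof.
apply/seteqP; split=> // q _; exists (orbit_repr q) => //.
rewrite /cap /= dotxx normr1; lra.
Qed.

Definition cap_cover : cech_cover (inf_projective R) :=
  CechCover (fun p => open_invariant (@cap_opp p) (cap_open p)) cap_full.

Definition sign_cochain : cochain 'F_2 (cover_index cap_cover) 1 :=
  fun s => (dot (s ord0) (s ord_max) < 0)%R%:R.

(** Relative to a lift of a common point, each edge value is the sum of the signs of its two
    vertices by [dot_sign], and every vertex of a triangle occurs twice. *)
Lemma sign_cochain_cocycle : cocycle cap_cover sign_cochain.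
Proof.
move=> s [q sq]; have {}sq k : cap (s k) (orbit_repr q) by exact: sq.
rewrite coboundaryE !big_ord_recl big_ord0 addr0 /sign_cochain.
rewrite !(dot_sign (sq _) (sq _)) !F2_addb.
pose f k : 'F_2 := (dot (s k) (orbit_repr q) < 0)%R%:R.
have -> : lift ord0 (ord_max : 'I_2) = lift (lift ord0 ord0) ord_max :> 'I_3.
  exact: val_inj.
have -> : lift (lift ord0 ord0) (ord0 : 'I_2) =
    lift (lift ord0 (lift ord0 ord0)) ord0 :> 'I_3.
  exact: val_inj.
have -> : lift ord0 (ord0 : 'I_2) =
    lift (lift ord0 (lift ord0 ord0)) ord_max :> 'I_3.
  exact: val_inj.
rewrite -/(f _) -/(f _) -/(f _).
set a := f _; set b := f _; set c := f _.
have -> : a + b + (c + b + (c + a)) = (a + a) + (b + b) + (c + c) by ring.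
by rewrite !F2_addrr ?addr0.
Qed.

(** If the cocycle bounds [b] on a refinement, correcting the sign of [dot (r j) x] by [b] removes
    the dependence on [j]. The local signs then glue to an odd locally constant function on the
    sphere. *)
Lemma sign_cochain_generator : generator sign_cochain.
Proof.
split; first exact: sign_cochain_cocycle.
case=> V [r [Vr [b bP]]].
pose beta j : bool := b (fun=> j) == 1.
pose pr := orbit_proj (antipodal R).
have cov x : exists j, V j (pr x).
  have : [set: inf_projective R] (pr x) by [].
  by rewrite -(cover_full V) => -[j _ Vj]; exists j.
have Vcap j x : V j (pr x) -> cap (r j) x.
  by move=> /Vr /(invariant_repr (@cap_opp (r j))).
have [idx idxP] := choice cov.
pose h j x := (dot (r j) x < 0) (+) beta j.
have hE j k x : V j (pr x) -> V k (pr x) -> h j x = h k x.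
  move=> Vj Vk.
  have := bP (fun i : 'I_2 => if i == ord0 then j else k).
  have ns : nerve V (fun i : 'I_2 => if i == ord0 then j else k).
    by exists (pr x) => i _; case: ifP.
  move=> /(_ ns); rewrite /pull_cochain /sign_cochain /=.
  rewrite (dot_sign (Vcap _ _ Vj) (Vcap _ _ Vk)).
  rewrite coboundaryE !big_ord_recl big_ord0 addr0.
  have -> : (fun i : 'I_1 => if lift ord0 i == ord0 then j else k) = fun=> k by [].
  have -> : (fun i : 'I_1 => if lift (lift ord0 ord0) i == ord0 then j else k) =
      fun=> j.
    by apply/funext; case=> -[].
  have bE i : b (fun=> i) = (beta i)%:R.
    by rewrite /beta; case: (b _) => -[|[|//]] i0; apply/val_inj.
  rewrite !bE -F2_addb /h.
  by case: (_ < 0); case: (_ < 0); case: (beta j); case: (beta k) => // /(congr1 val).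
pose g x := h (idx x) x.
apply: (@no_odd_locally_constant R g) => [x|c].
  have opx : pr (sphere_opp x) = pr x by exact: (orbit_proj_act (antipodal R)).
  rewrite /g (hE _ (idx x)) //; last by rewrite opx.
  have := Vcap _ _ (idxP x); rewrite /h dotNr oppr_lt0 /cap /=.
  case: (ltgtP (dot _ x) 0) => [d0 _|d0 _|-> /=]; rewrite ?negbK//.
  by rewrite normr0; lra.
(* On [V j], where [dot (r j)] does not vanish, this open condition is equivalent to [h j x = c]. *)
pose S j := [set x | if c (+) beta j then dot (r j) x < 0 else 0 < dot (r j) x].
have -> : [set x | g x = c] = \bigcup_j ((pr @^-1` V j) `&` S j).
  apply/seteqP; split=> x.
    move=> gx; exists (idx x) => //; split; first exact: idxP.
    have := Vcap _ _ (idxP x).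
    move: gx; rewrite /g /h /S /cap /= => <-; rewrite addbK.
    by case: (ltgtP (dot _ x) 0) => // ->; rewrite normr0; lra.
  case=> j _ [/= Vj]; rewrite /S /g /= (hE _ j)// /h.
  by case: {S} c; case: (beta j) => /=; case: (ltgtP (dot _ x) 0).
apply: bigcup_open => j _; apply: openI.
  apply: open_comp; last exact: cover_open.
  by move=> x _; exact: orbit_proj_continuous.
rewrite /S; case: (c (+) beta j).
  apply: (@open_comp _ _ (dot (r j)) [set y | y < 0]); last exact: open_lt.
  by move=> x _; exact: dot_continuous.
apply: (@open_comp _ _ (dot (r j)) [set y | 0 < y]); last exact: open_gt.
by move=> x _; exact: dot_continuous.
Qed.

End Generator.

(** * Vanishing of the power over the Borel construction *)

Lemma open_forall (T : topologicalType) (I : finType) (P : I -> set T) :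
  (forall i, open (P i)) -> open [set x | forall i, P i x].
Proof.
move=> Po; rewrite openE => x Px; apply: filter_forall => i.
by apply: open_nbhs_nbhs; split; [exact: Po|exact: Px].
Qed.

Lemma pull_cup_exp (I J : Type) (r : J -> I) (w : cochain 'F_2 I 1) m :
  pull_cochain r (cup_exp w m) = cup_exp (pull_cochain r w) m.
Proof. by elim: m => //= m <-. Qed.

Section PowerZero.
Variables (R : realType) (X : topologicalType) (sigma : z2_action X) (n : nat).
Variable phi : 'I_n -> X -> R.
Hypotheses (phi_continuous : forall k, continuous (phi k))
  (phi_odd : forall k x, phi k (sigma x) = - phi k x)
  (phi_neq0 : forall x, exists k, phi k x != 0).

Local Notation E := (X * inf_sphere R)%type.
Local Notation act := (diag_action sigma (antipodal R)).
Local Notation idx := ({set 'I_n} * inf_sphere R * ('I_n -> bool))%type.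

(** Both factors are odd, so the sign of the product is well defined on orbits. *)
Definition signed_prod (p : inf_sphere R) k (e : E) := dot p e.2 * phi k e.1.

(** The component [j.2] prescribes the signs of the products with index in [j.1.1]; strict
    inequalities keep the condition open. *)
Definition sign_cond (j : idx) k : set E :=
  if k \in j.1.1 then
    if j.2 k then [set e | signed_prod j.1.2 k e < 0]
    else [set e | 0 < signed_prod j.1.2 k e]
  else \bigcup_l [set e | `|phi k e.1| < `|phi l e.1|].

(* The set [j.1.1] records at which indices [k] the maximum of [|phi k|] is
   attained: a point where it is attained at [k] lies only in cells [j] such that
   [k \in j.1.1], and [phi k] vanishes nowhere on these.  This
   plays the role of a star refinement of the cover by the sets [phi k != 0]. *)
Definition cell (j : idx) : set E :=
  (snd @^-1` cap j.1.2) `&` [set e | forall k, sign_cond j k e].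

Lemma cell_open j : open (cell j).
Proof.
have c1 k : continuous (fun e : E => phi k e.1).
  by move=> e; apply: continuous_comp; [exact: cvg_fst|exact: phi_continuous].
have c2 : continuous (fun e : E => dot j.1.2 e.2).
  by move=> e; apply: continuous_comp; [exact: cvg_snd|exact: dot_continuous].
have c3 k : continuous (signed_prod j.1.2 k) by exact: continuous_mul_fun.
apply: openI.
  by apply: open_comp; [move=> e _; exact: cvg_snd|exact: cap_open].
apply: open_forall => k; rewrite /sign_cond; case: ifP => _.
  case: ifP => _.
    apply: (@open_comp _ _ (signed_prod j.1.2 k) [set y | y < 0]); last exact: open_lt.
    by move=> e _; exact: c3.
  apply: (@open_comp _ _ (signed_prod j.1.2 k) [set y | 0 < y]); last exact: open_gt.
  by move=> e _; exact: c3.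
apply: bigcup_open => l _.
rewrite (_ : [set _ | _] =
    (fun e : E => `|phi l e.1| - `|phi k e.1|) @^-1` [set y | 0 < y]).
  apply: open_comp; last exact: open_gt.
  move=> e _; apply: continuous_add_fun; first exact: continuous_norm_fun.
  by apply: continuous_opp_fun; exact: continuous_norm_fun.
by apply/seteqP; split=> e /=; rewrite subr_gt0.
Qed.

Lemma cell_act j e : cell j e -> cell j (act e).
Proof.
case=> je ke; split; first exact: cap_opp.
move=> k; have := ke k; rewrite /sign_cond; case: ifP => _.
  by case: ifP => _ /=; rewrite /signed_prod /= phi_odd dotNr mulrNN.
by case=> l _ /= kl; exists l => //=; rewrite !phi_odd !normrN.
Qed.

Lemma cell_full : \bigcup_j [set q : borel_space R sigma | cell j (orbit_repr q)] = setT.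
Proof.
apply/seteqP; split=> // q _; set e := orbit_repr q.
pose S := [set k | [forall l, `|phi l e.1| <= `|phi k e.1|]]%SET.
(* The cap is centred at [e.2] itself, so the product at [e] is [phi k e.1], nonzero where the
   modulus is maximal. *)
exists ((S, e.2), (fun k => signed_prod e.2 k e < 0)) => //.
rewrite /= -/e; split; first by rewrite /cap /= dotxx normr1; lra.
move=> k; rewrite /sign_cond /= inE.
case: ifPn => [/forallP kmax|/forallPn[l]]; last first.
  by rewrite -ltNge => kl; exists l.
have : signed_prod e.2 k e != 0.
  rewrite /signed_prod dotxx mul1r; have [l] := phi_neq0 e.1.
  by apply: contraNneq => k0; have := kmax l; rewrite k0 normr0 normr_le0.
by case: ifPn => //; rewrite -leNgt /= lt_neqAle eq_sym => -> ->.
Qed.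

Definition cell_cover : cech_cover (borel_space R sigma) :=
  CechCover (fun j => open_invariant (@cell_act j) (@cell_open j)) cell_full.

(** On each simplex of the nerve the factor whose index maximizes [|phi k|] at a common point
    vanishes. Which factor it is may vary with the simplex. *)
Lemma power_zero_sign_cochain : power_zero sigma (@sign_cochain R) n.
Proof.
pose r (j : cover_index cell_cover) : cover_index (cap_cover R) := j.1.2.
have rV j : cell_cover j `<=`
    preim_cover (@borel_proj_continuous R X sigma) (cap_cover R) (r j).
  move=> q [jq _]; apply/(invariant_repr (@cap_opp R (r j))); exact: jq.
exists cell_cover, r; split=> //; rewrite pull_cup_exp.
set w := pull_cochain r _.
have wc : cocycle cell_cover w.
  move=> s [q sq]; apply: (sign_cochain_cocycle (s := r \o s)).
  by exists (borel_proj q) => k _; apply: rV; exact: sq.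
(* The 0-cochain of prescribed signs; the default 0 applies only from index [n] on, beyond the [n]
   factors. *)
pose a (k : nat) (j : idx) : 'F_2 :=
  if insub k is Some i then (j.2 i)%:R else 0.
apply: (cup_exp_exact wc (a := a)) => s [q sq]; set e := orbit_repr q.
have se i : cell (s i) e by exact: sq.
have [k0 _] := phi_neq0 e.1.
have [k kmax] : exists k, forall l, `|phi l e.1| <= `|phi k e.1|.
  by case: (@arg_maxP _ _ _ k0 predT (fun k => `|phi k e.1|)) => // k _ kmax;
    exists k => l; exact: kmax.
(* Maximality puts [k] in the index set of every vertex. The sign of [phi k e.1] is common to all
   vertices and cancels in sums of two, leaving the value of [w]. *)
have sk i : (s i).2 k = (dot (s i).1.2 e.2 < 0) (+) (phi k e.1 < 0).
  have [_ /(_ k)] := se i; rewrite /sign_cond; case: ifP => _; last first.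
    by case=> l _ /=; rewrite ltNge kmax.
  rewrite /signed_prod; case: ifP => _ /=;
    case: (ltP (dot _ _) 0) => d0; case: (ltP (phi _ _) 0) => p0 //=; nra.
apply: (twist_prod_eq0 (i := k)) => // f fs; rewrite /twist /a add0n valK.
have [[x fx] [y fy]] := (fs ord0, fs ord_max).
have [[capx _] [capy _]] := (se x, se y).
rewrite /w /pull_cochain /sign_cochain /r /= fx fy.
rewrite (dot_sign capx capy) !sk -!F2_addb.
by case: (_ < 0); case: (_ < 0); case: (_ < 0).
Qed.


End PowerZero.

Theorem theorem3p9 (R : realType) (X : metricType R) (sigma : z2_action X)
    (n N : nat) (U : 'I_N -> set X)
    (X_compact : compact [set: X])
    (ind_X : ind_eq R sigma n)
    (U_closed : forall i, closed (U i))
    (U_cover : \bigcup_i U i = [set: X])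
    (U_antipodal : forall i, ~ exists x, U i x /\ U i (sigma x)) :
  exists x : X,
    (n + 2 <= #|[set i : 'I_N | `[< U i x \/ U i (sigma x) >]]%SET|)%N.
Proof.
apply: contrapT => few.
have Ucard x : (#|[set i : 'I_N | `[< U i x \/ U i (sigma x) >]]%SET| <= n.+1)%N.
  by rewrite -ltnS ltnNge -addn2; apply/negP => xn; apply: few; exists x.
have [psi [psic psiN psicard]] :=
  odd_family_of_cover U_closed U_cover U_antipodal Ucard.
have [phi [phic phiN phi0]] := odd_family_nowhere_zero psic psiN psicard.
(* [ind_eq] quantifies over representatives of the generator, so an explicit one must be
   supplied. *)
have [wn _] := ind_X _ _ (@sign_cochain_generator R).
by apply: wn; exact: (power_zero_sign_cochain phic phiN phi0).
Qed.
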